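(* Fix a sample $X = \{x_1,\ldots, x_n\}\subset\mathbb{R}^d$ and positive weights $w_1,\dots,w_n$ with $\sum_i w_i=1$. If the log-concave $\mathrm{MTP}_2$ MLE for $X$ exists, then its support $\{f>0\}$ equals the min-max convex hull $\mathrm{MMconv}(X)$. If the log-concave LLC MLE for $X$ exists, then its support equals the $L^\natural$-extension $L(X)$.
   Context: For $x,y\in\mathbb{R}^d$, $x\wedge y$ and $x\vee y$ denote the coordinatewise minimum and maximum, and $\mathbf 1=(1,\dots,1)$. A density is a measurable function $f:\mathbb{R}^d\to[0,\infty)$ with $\int f=1$. It is log-concave if $f(x)^\lambda f(y)^{1-\lambda}\le f(\lambda x+(1-\lambda)y)$ for all $x,y$, $\lambda\in[0,1]$; it is $\mathrm{MTP}_2$ if $f(x)f(y)\le f(x\wedge y)f(x\vee y)$ for all $x,y$; it is log-$L^\natural$-concave (LLC) if $f(x)f(y)\le f((x+\alpha\mathbf 1)\wedge y)f(x\vee(y-\alpha\mathbf 1))$ for all $\alpha\ge0$ and all $x,y$. The log-concave $\mathrm{MTP}_2$ (respectively LLC) MLE is a maximizer of $\sum_{i=1}^n w_i\log f(x_i)$ over all densities $f$ on $\mathbb{R}^d$ that are log-concave and $\mathrm{MTP}_2$ (respectively log-concave and LLC). A subset of $\mathbb{R}^d$ is min-max closed if it contains $u\wedge v$ and $u\vee v$ whenever it contains $u$ and $v$. $\mathrm{MMconv}(X)$ is the smallest min-max closed and convex set containing $X$. A set $Y\subseteq\mathbb{R}^d$ is $L^\natural$-convex if $x,y\in Y$ implies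 $(x+\alpha\mathbf 1)\wedge y\in Y$ and $x\vee(y-\alpha\mathbf 1)\in Y$ for all real $\alpha\ge0$. $L(X)$ is the smallest $L^\natural$-convex set in $\mathbb{R}^d$ containing $X$. *)

(* Defs.v *)
From HB Require Import structures.
From mathcomp Require Import all_boot all_order all_algebra.
From mathcomp Require Import all_classical all_reals all_analysis.

Set Implicit Arguments.
Unset Strict Implicit.
Unset Printing Implicit Defensive.

Import Order.TTheory GRing.Theory Num.Theory.
Import numFieldNormedType.Exports.

Local Open Scope classical_set_scope.
Local Open Scope ring_scope.

(* R^d is 'rV[R]_d, with the sigma-algebra generated by the coordinates, i.e.
   the Borel sigma-algebra. *)

Definition rV_display : measure_display.
Proof. exact: default_measure_display. Qed.

Section measurable_rV.
Variables (R : realType) (d : nat).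

Let coor : 'I_d -> 'rV[R]_d -> R := fun i x => x ord0 i.

Let rV_set0 : g_sigma_preimage coor set0.
Proof. exact: sigma_algebra0. Qed.

Let rV_setC A : g_sigma_preimage coor A -> g_sigma_preimage coor (~` A).
Proof. exact: sigma_algebraC. Qed.

Let rV_bigcup (F : (set 'rV[R]_d)^nat) :
  (forall i, g_sigma_preimage coor (F i)) ->
  g_sigma_preimage coor (\bigcup_i F i).
Proof. exact: sigma_algebra_bigcup. Qed.

HB.instance Definition _ := @isMeasurable.Build rV_display
  'rV[R]_d (g_sigma_preimage coor) rV_set0 rV_setC rV_bigcup.

End measurable_rV.

Lemma measurable_coor (R : realType) (d : nat) (i : 'I_d) :
  measurable_fun [set: 'rV[R]_d] (fun x : 'rV[R]_d => x ord0 i).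
Proof.
move=> _ Y mY; rewrite setTI; apply: sub_sigma_algebra => /=.
rewrite -bigcup_seq/=; exists i => /=; first by rewrite mem_index_enum.
by exists Y => //; rewrite setTI.
Qed.

Lemma measurable_fun_coorP (dT : measure_display) (T : measurableType dT)
    (R : realType) (d : nat) (f : T -> 'rV[R]_d) :
  measurable_fun [set: T] f <->
  forall i, measurable_fun [set: T] (fun t => f t ord0 i).
Proof.
split=> [mf i|mf].
  exact: (measurableT_comp (@measurable_coor R d i) mf).
move=> _ Y mY; move: Y mY.
pose S := image_set_system setT f (@measurable _ T).
suff : @measurable _ 'rV[R]_d `<=` S.
  by move=> + Y mY => /(_ _ mY); rewrite /S /image_set_system.
apply: smallest_sub.
  exact/sigma_algebra_image/sigma_algebra_measurable.
rewrite -bigcup_seq => A [i _ [B mB <-]].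
rewrite /S /image_set_system /= !setTI.
by have := mf i measurableT B mB; rewrite setTI.
Qed.

Lemma sigma_finite_product_measure1 (d1 d2 : measure_display)
    (T1 : measurableType d1) (T2 : measurableType d2) (R : realType)
    (m1 : {sigma_finite_measure set T1 -> \bar R})
    (m2 : {sigma_finite_measure set T2 -> \bar R}) :
  sigma_finite setT (m1 \x m2)%E.
Proof.
have /sigma_finiteP[F [TF ndF Foo]] := sigma_finiteT m1.
have /sigma_finiteP[G [TG ndG Goo]] := sigma_finiteT m2.
exists (fun n => F n `*` G n).
  rewrite -setXTT TF TG predeqE => -[x y]; split.
    move=> [/= [n _ Fnx] [k _ Gky]]; exists (maxn n k) => //; split.
    - by move: x Fnx; exact/subsetPset/ndF/leq_maxl.
    - by move: y Gky; exact/subsetPset/ndG/leq_maxr.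
  by move=> [n _ []/= ? ?]; split; exists n.
move=> k; have [? ?] := Foo k; have [? ?] := Goo k.
split; first exact: measurableX.
by rewrite product_measure1E// lte_mul_pinfty// ge0_fin_numE.
Qed.

Section lebesgue_rV_construction.
Variable R : realType.

Definition consrV (d : nat) (p : R * 'rV[R]_d) : 'rV[R]_d.+1 :=
  \row_(i < d.+1) oapp (fun j => p.2 ord0 j) p.1 (unlift ord0 i).

Definition unconsrV (d : nat) (x : 'rV[R]_d.+1) : R * 'rV[R]_d :=
  (x ord0 ord0, \row_(j < d) x ord0 (lift ord0 j)).

Lemma consrVK d : cancel (@consrV d) (@unconsrV d).
Proof.
move=> [a v]; rewrite /unconsrV /consrV; congr (_, _).
  by rewrite mxE unlift_none.
by apply/rowP => j; rewrite !mxE liftK.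
Qed.

Lemma unconsrVK d : cancel (@unconsrV d) (@consrV d).
Proof.
move=> x; apply/rowP => i; rewrite mxE.
by case: unliftP => [j ->|->] //=; rewrite mxE.
Qed.

Lemma measurable_consrV d : measurable_fun setT (@consrV d).
Proof.
apply/measurable_fun_coorP => i; rewrite /consrV.
under eq_fun do rewrite mxE.
case: unliftP => [j _|_] /=; last exact: measurable_fst.
exact: (measurableT_comp (@measurable_coor R d j)).
Qed.

Lemma measurable_unconsrV d : measurable_fun setT (@unconsrV d).
Proof.
apply/measurable_fun_pairP; split.
  exact: measurable_coor.
apply/measurable_fun_coorP => i /=.
under eq_fun do rewrite /= mxE.
exact: measurable_coor.
Qed.

Section step.
Variables (d : nat) (m : {sigma_finite_measure set 'rV[R]_d -> \bar R}).

Definition lebesgue_step : set 'rV[R]_d.+1 -> \bar R :=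
  pushforward (lebesgue_measure \x m)%E (@consrV d).

Let step0 : lebesgue_step set0 = 0%E.
Proof. by rewrite /lebesgue_step /pushforward preimage_set0 measure0. Qed.

Let step_ge0 A : (0 <= lebesgue_step A)%E.
Proof. by rewrite /lebesgue_step /pushforward; exact: measure_ge0. Qed.

Let mpre (A : set 'rV[R]_d.+1) : measurable A ->
  measurable (@consrV d @^-1` A).
Proof.
by move=> mA; rewrite -[X in measurable X]setTI; exact: measurable_consrV.
Qed.

Let step_sigma_additive : semi_sigma_additive lebesgue_step.
Proof.
move=> F mF tF mUF; rewrite /lebesgue_step /pushforward preimage_bigcup.
apply: measure_semi_sigma_additive.
- by move=> n; exact: mpre.
- apply/trivIsetP => /= i j _ _ ij; rewrite -preimage_setI.
  by move/trivIsetP : tF => /(_ _ _ _ _ ij) ->//; rewrite preimage_set0.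
- by rewrite -preimage_bigcup; exact: mpre.
Qed.

HB.instance Definition _ := isMeasure.Build _ _ _ lebesgue_step
  step0 step_ge0 step_sigma_additive.

Let step_sigma_finite : sigma_finite setT lebesgue_step.
Proof.
have [G TG Gfin] : sigma_finite setT
    ((@lebesgue_measure R : {sigma_finite_measure set _ -> \bar R}) \x m)%E.
  exact: sigma_finite_product_measure1.
exists (fun n => @unconsrV d @^-1` G n).
  by rewrite -preimage_bigcup -TG preimage_setT.
move=> n; have [mG Goo] := Gfin n; split.
  by rewrite -[X in measurable X]setTI; exact: measurable_unconsrV.
rewrite /lebesgue_step /pushforward -comp_preimage.
by rewrite (_ : _ \o _ = id) ?preimage_id//; apply/funext => p; exact: consrVK.
Qed.

HB.instance Definition _ :=
  Measure_isSigmaFinite.Build _ _ _ lebesgue_step step_sigma_finite.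

End step.

End lebesgue_rV_construction.

(* Lebesgue measure on R^d: a Dirac mass on the one-point space R^0, and the
   product of d copies of the one-dimensional Lebesgue measure for d > 0. *)
Fixpoint lebesgue_rV (R : realType) (d : nat) :
    {sigma_finite_measure set 'rV[R]_d -> \bar R} :=
  match d with
  | 0%N => \d_(0 : 'rV[R]_0)
  | d'.+1 => lebesgue_step (lebesgue_rV R d')
  end.

Lemma lebesgue_rV_box (R : realType) (d : nat) (a b : 'rV[R]_d) :
  (forall i, a ord0 i <= b ord0 i) ->
  lebesgue_rV R d [set x | forall i, x ord0 i \in `[a ord0 i, b ord0 i]] =
  (\prod_(i < d) (b ord0 i - a ord0 i))%:E.
Proof.
elim: d a b => [|d IH] a b ab /=.
  rewrite big_ord0 diracE mem_set//; by case.
rewrite /lebesgue_step /pushforward.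
set A := _ @^-1` _.
pose a' : 'rV[R]_d := \row_j a ord0 (lift ord0 j).
pose b' : 'rV[R]_d := \row_j b ord0 (lift ord0 j).
set B := [set x : 'rV[R]_d | forall i, x ord0 i \in `[a' ord0 i, b' ord0 i]].
have AE : A = `[a ord0 ord0, b ord0 ord0]%classic `*` B.
  apply/seteqP; split => -[x v] /=.
    move=> H; split.
      by have := H ord0; rewrite mxE unlift_none /=.
    by move=> j; have := H (lift ord0 j); rewrite !mxE liftK.
  move=> [Hx Hv] i; rewrite mxE; case: unliftP => [j ->|->] //=.
  by have := Hv j; rewrite !mxE.
have mB : measurable B.
  rewrite (_ : B = \bigcap_(i in [set: 'I_d])
      ((fun x : 'rV[R]_d => x ord0 i) @^-1` `[a' ord0 i, b' ord0 i]%classic)).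
    apply: fin_bigcap_measurable; first exact: finite_finset.
    move=> i _; rewrite -[X in measurable X]setTI.
    by apply: measurable_coor => //; exact: measurable_itv.
  by apply/seteqP; split => x /= H i; [move=> _|]; exact: H.
rewrite AE product_measure1E//=.
rewrite lebesgue_measure_itv /= IH; last by move=> i; rewrite !mxE.
rewrite big_ord_recl lte_fin EFinM; congr (_ * _)%E.
  case: ltP => // h; congr EFin; apply/eqP.
  by rewrite eq_sym subr_eq0 eq_le ab h.
by congr EFin; apply: eq_bigr => i _; rewrite !mxE.
Qed.

Section shape_constraints.
Variables (R : realType) (d : nat).
Implicit Types (x y : 'rV[R]_d) (f : 'rV[R]_d -> R) (Y : set 'rV[R]_d).

Definition meetv x y : 'rV[R]_d := map2_mx Num.min x y.
Definition joinv x y : 'rV[R]_d := map2_mx Num.max x y.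

Definition density f : Prop :=
  [/\ measurable_fun setT f, forall x, 0 <= f x &
      (\int[lebesgue_rV R d]_x (f x)%:E = 1)%E].

(* powR satisfies 0 `^ 0 = 1 and 0 `^ l = 0 for l > 0. *)
Definition log_concave f : Prop := forall x y (l : R), 0 <= l <= 1 ->
  f x `^ l * f y `^ (1 - l) <= f (l *: x + (1 - l) *: y).

Definition MTP2 f : Prop := forall x y,
  f x * f y <= f (meetv x y) * f (joinv x y).

Definition LLC f : Prop := forall (alpha : R) x y, 0 <= alpha ->
  f x * f y <=
    f (meetv (x + const_mx alpha) y) * f (joinv x (y - const_mx alpha)).

Definition minmax_closed Y : Prop := forall u v, Y u -> Y v ->
  Y (meetv u v) /\ Y (joinv u v).

Definition MMconv X : set 'rV[R]_d :=
  smallest [set Y | minmax_closed Y /\ convex_set Y] X.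

Definition Lnat_convex Y : Prop := forall x y, Y x -> Y y ->
  forall alpha : R, 0 <= alpha ->
    Y (meetv (x + const_mx alpha) y) /\ Y (joinv x (y - const_mx alpha)).

Definition Lext X : set 'rV[R]_d := smallest Lnat_convex X.

Section likelihood.
Variables (n : nat) (x : 'I_n -> 'rV[R]_d) (w : 'I_n -> R).

(* Extended-real valued because log 0 = -oo, whereas ln 0 = 0 in the library. *)
Definition loglik f : \bar R := (\sum_(i < n) (w i)%:E * lne (f (x i))%:E)%E.

Definition maximizes_loglik (F : set ('rV[R]_d -> R)) f : Prop :=
  F f /\ forall g, F g -> (loglik g <= loglik f)%E.

Definition is_log_concave_MTP2_MLE f : Prop :=
  maximizes_loglik [set g | [/\ density g, log_concave g & MTP2 g]] f.

Definition is_log_concave_LLC_MLE f : Prop :=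
  maximizes_loglik [set g | [/\ density g, log_concave g & LLC g]] f.

End likelihood.

End shape_constraints.

(* Main.v *)
Require Import Defs.
From mathcomp Require Import all_boot all_order all_algebra.
From mathcomp Require Import all_classical all_reals all_analysis.
From mathcomp Require Import measurable_realfun.
From mathcomp Require Import ring lra.

Set Implicit Arguments.
Unset Strict Implicit.
Unset Printing Implicit Defensive.

Import Order.TTheory GRing.Theory Num.Theory.
Import numFieldNormedType.Exports.

Local Open Scope classical_set_scope.
Local Open Scope ring_scope.

(** The hull is the intersection of bounded measurable neighbourhoods K m of
    the sample with the same shape. The uniform density on K m is a competitor
    of the MLE f, so the volumes of the K m are bounded below, the hull has
    positive volume, and f is positive on the sample, hence on the hull. The
    normalized restriction of f to the hull is another competitor: so f has no
    mass outside the hull. If f were positive at some z outside the hull, then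
    by convexity of its support it would be positive on a contraction of the
    hull towards z, small enough to miss the hull, and would have mass there. *)

(** * Convexity, min-max closedness and $L^\natural$-convexity of sets *)

Section geometry.
Variables (R : realType) (d : nat).
Implicit Types (u v y z : 'rV[R]_d) (A C Y : set 'rV[R]_d) (e : R).

Lemma convex_set_combP Y : convex_set Y <->
  forall u v (l : R), 0 <= l <= 1 -> Y u -> Y v -> Y (l *: u + (1 - l) *: v).
Proof.
split=> [cY u v l l01 Yu Yv|cY u v l /set_mem Yu /set_mem Yv].
  have := cY u v (Itv01 (andP l01).1 (andP l01).2) (mem_set Yu) (mem_set Yv).
  by move/set_mem.
by apply/mem_set; apply: cY => //; apply/andP; split; [exact: ge0|exact: le1].
Qed.

Lemma convex_bigcap (I : Type) (P : set I) (F : I -> set 'rV[R]_d) :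
  (forall i, P i -> convex_set (F i)) -> convex_set (\bigcap_(i in P) F i).
Proof.
move=> cF; apply/convex_set_combP => u v l l01 Fu Fv i Pi.
by have /convex_set_combP := cF i Pi; apply => //; [exact: Fu|exact: Fv].
Qed.

Lemma minmax_bigcap (I : Type) (P : set I) (F : I -> set 'rV[R]_d) :
  (forall i, P i -> minmax_closed (F i)) -> minmax_closed (\bigcap_(i in P) F i).
Proof.
move=> cF u v Fu Fv.
by split=> i Pi; have [] := cF i Pi u v (Fu i Pi) (Fv i Pi).
Qed.

Lemma Lnat_bigcap (I : Type) (P : set I) (F : I -> set 'rV[R]_d) :
  (forall i, P i -> Lnat_convex (F i)) -> Lnat_convex (\bigcap_(i in P) F i).
Proof.
move=> cF u v Fu Fv a a0.
by split=> i Pi; have [] := cF i Pi u v (Fu i Pi) (Fv i Pi) a a0.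
Qed.

Lemma Lnat_minmax Y : Lnat_convex Y -> minmax_closed Y.
Proof.
move=> LY u v Yu Yv; have [] := LY u v Yu Yv 0 (lexx _).
by rewrite (_ : const_mx 0 = 0) ?addr0 ?subr0.
Qed.

Definition bigmeetv (n : nat) (F : 'I_n.+1 -> 'rV[R]_d) : 'rV[R]_d :=
  \big[@meetv R d/F ord0]_i F i.
Definition bigjoinv (n : nat) (F : 'I_n.+1 -> 'rV[R]_d) : 'rV[R]_d :=
  \big[@joinv R d/F ord0]_i F i.

Lemma bigmeetv_le (n : nat) (F : 'I_n.+1 -> 'rV[R]_d) i k :
  bigmeetv F ord0 k <= F i ord0 k.
Proof.
rewrite /bigmeetv (big_morph (fun v => v ord0 k) (op1 := Num.min)
   (id1 := F ord0 ord0 k))//; last by move=> u v; rewrite mxE.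
exact: bigmin_le.
Qed.

Lemma bigmeetv_ge (n : nat) (F : 'I_n.+1 -> 'rV[R]_d) k (a : R) :
  (forall i, a <= F i ord0 k) -> a <= bigmeetv F ord0 k.
Proof.
move=> aF; rewrite /bigmeetv; elim/big_ind: _ => //.
by move=> u v au av; rewrite mxE le_min au av.
Qed.

Lemma bigjoinv_ge (n : nat) (F : 'I_n.+1 -> 'rV[R]_d) i k :
  F i ord0 k <= bigjoinv F ord0 k.
Proof.
rewrite /bigjoinv (big_morph (fun v => v ord0 k) (op1 := Num.max)
   (id1 := F ord0 ord0 k))//; last by move=> u v; rewrite mxE.
exact: (le_bigmax _ (fun i => F i ord0 k) i).
Qed.

Lemma bigjoinv_le (n : nat) (F : 'I_n.+1 -> 'rV[R]_d) k (a : R) :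
  (forall i, F i ord0 k <= a) -> bigjoinv F ord0 k <= a.
Proof.
move=> aF; rewrite /bigjoinv; elim/big_ind: _ => //.
by move=> u v au av; rewrite mxE ge_max au av.
Qed.

Lemma minmax_closed_bigmeetv Y (n : nat) (F : 'I_n.+1 -> 'rV[R]_d) :
  minmax_closed Y -> (forall i, Y (F i)) -> Y (bigmeetv F).
Proof.
by move=> mY YF; apply: big_ind => // u v Yu Yv; have [] := mY u v Yu Yv.
Qed.

Lemma minmax_closed_bigjoinv Y (n : nat) (F : 'I_n.+1 -> 'rV[R]_d) :
  minmax_closed Y -> (forall i, Y (F i)) -> Y (bigjoinv F).
Proof.
by move=> mY YF; apply: big_ind => // u v Yu Yv; have [] := mY u v Yu Yv.
Qed.

End geometry.

(* A point is recovered as max_i min_j u^(i,j) as soon as u^(i,j) lies above it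
   in coordinate i and below it in coordinate j. *)
Lemma minmax_closed_pairwise (R : realType) (d : nat) (Y : set 'rV[R]_d)
    (z : 'rV[R]_d) : Y !=set0 -> minmax_closed Y ->
  (forall i j, exists u, [/\ Y u, z ord0 i <= u ord0 i & u ord0 j <= z ord0 j]) ->
  Y z.
Proof.
case: d Y z => [|d] Y z [y0 Yy0] mY /= H.
  by rewrite (_ : z = y0)//; apply/rowP => -[].
have /choice[u uP] : forall p : 'I_d.+1 * 'I_d.+1, exists u,
    [/\ Y u, z ord0 p.1 <= u ord0 p.1 & u ord0 p.2 <= z ord0 p.2].
  by move=> [i j]; exact: H.
pose v i := bigmeetv (fun j => u (i, j)).
have -> : z = bigjoinv v.
  apply/rowP => k; apply/le_anti/andP; split.
    apply: (le_trans _ (bigjoinv_ge _ k _)).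
    by apply: bigmeetv_ge => j; have [] := uP (k, j).
  apply: bigjoinv_le => i; apply: (le_trans (bigmeetv_le _ k _)).
  by have [] := uP (i, k).
apply: minmax_closed_bigjoinv => // i; apply: minmax_closed_bigmeetv => // j.
by have [] := uP (i, j).
Qed.

(** One of the weights [t] and [1 - t] is positive, which keeps the inequality strict even at the
    endpoints. *)
Lemma comb_lt (R : realFieldType) (t a b a' b' : R) : 0 <= t <= 1 ->
  a < b -> a' < b' -> t * a + (1 - t) * a' < t * b + (1 - t) * b'.
Proof.
move=> /andP[]; rewrite le_eqVlt => /orP[/eqP <-|t0] t1 ab ab'.
  by rewrite !mul0r subr0 !mul1r !add0r.
by apply: ltr_leD; [rewrite ltr_pM2l|rewrite ler_wpM2l ?subr_ge0 ?(ltW ab')].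
Qed.

Lemma measurable_ltr_set (dT : measure_display) (T : measurableType dT)
    (R : realType) (f : T -> R) (r : R) : measurable_fun setT f ->
  measurable [set t | f t < r].
Proof.
move=> mf; have -> : [set t | f t < r] = setT `&` f @^-1` `]-oo, r[%classic.
  by rewrite setTI; apply/seteqP; split=> t /=; rewrite in_itv.
by apply: mf => //; exact: measurable_itv.
Qed.

Lemma measurable_gtr_set (dT : measure_display) (T : measurableType dT)
    (R : realType) (f : T -> R) (r : R) : measurable_fun setT f ->
  measurable [set t | r < f t].
Proof.
move=> mf; have -> : [set t | r < f t] = setT `&` f @^-1` `]r, +oo[%classic.
  by rewrite setTI; apply/seteqP; split=> t /=; rewrite in_itv/= andbT.
by apply: mf => //; exact: measurable_itv.
Qed.

(** * Relaxed min-max convex hulls of the sample *)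

Section minmax_hull.
Variables (R : realType) (d n : nat) (x : 'I_n -> 'rV[R]_d).
Implicit Types (u v y z : 'rV[R]_d) (l : 'rV[R]_n).

Definition simplex : set 'rV[R]_n :=
  [set l | (forall k, 0 <= l ord0 k) /\ \sum_k l ord0 k = 1].

Definition mixture l : 'rV[R]_d := \sum_k l ord0 k *: x k.

Lemma simplex_vertex k : simplex (delta_mx ord0 k).
Proof.
split=> [i|]; first by rewrite mxE eqxx ler0n.
rewrite (bigD1 k)//= mxE !eqxx big1 ?addr0// => i ik.
by rewrite mxE (negbTE ik) andbF.
Qed.

Lemma mixture_vertex k : mixture (delta_mx ord0 k) = x k.
Proof.
rewrite /mixture (bigD1 k)//= mxE !eqxx scale1r big1 ?addr0// => i ik.
by rewrite mxE (negbTE ik) andbF scale0r.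
Qed.

Lemma simplex_comb l l' (t : R) : 0 <= t <= 1 -> simplex l -> simplex l' ->
  simplex (t *: l + (1 - t) *: l').
Proof.
move=> /andP[t0 t1] [l0 l1] [l0' l1']; split=> [k|].
  by rewrite !mxE addr_ge0// mulr_ge0// subr_ge0.
under eq_bigr do rewrite !mxE.
by rewrite big_split/= -!mulr_sumr l1 l1' !mulr1 subrKC.
Qed.

Lemma mixture_comb l l' (t : R) :
  mixture (t *: l + (1 - t) *: l') = t *: mixture l + (1 - t) *: mixture l'.
Proof.
rewrite /mixture !scaler_sumr -big_split/=; apply: eq_bigr => k _.
by rewrite !scalerA -scalerDl !mxE.
Qed.

Lemma convex_mixture (Y : set 'rV[R]_d) l : convex_set Y -> range x `<=` Y ->
  simplex l -> Y (mixture l).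
Proof.
move=> /convex_set_combP cY xY [l0 l1].
have xk k : Y (x k) by apply: xY; exists k.
(* The induction runs over partial mixtures renormalized by their total weight, which is 1 for the
   full index list. *)
suff H (s : seq 'I_n) : 0 < \sum_(k <- s) l ord0 k ->
    Y ((\sum_(k <- s) l ord0 k)^-1 *: \sum_(k <- s) l ord0 k *: x k).
  have := H (index_enum 'I_n).
  by rewrite l1 ltr01 invr1 scale1r; exact.
elim: s => [|k s IH]; first by rewrite big_nil ltxx.
rewrite !big_cons; set t := \sum_(j <- s) _; set S := \sum_(j <- s) _ => kt0.
have : 0 <= t by exact: sumr_ge0.
rewrite le_eqVlt => /orP[/eqP t0|t0].
  have -> : S = 0.
    rewrite /S big_seq big1// => j js.
    have /allP/(_ j js)/= : all (fun j => l ord0 j == 0) s.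
      move: t0 => /esym/eqP; rewrite psumr_eq0//.
    by move=> /eqP ->; rewrite scale0r.
  move: kt0; rewrite -t0 !addr0 => k0.
  by rewrite scalerA mulVf ?scale1r// gt_eqF.
have -> : (l ord0 k + t)^-1 *: (l ord0 k *: x k + S) =
    (l ord0 k / (l ord0 k + t)) *: x k
    + (1 - l ord0 k / (l ord0 k + t)) *: (t^-1 *: S).
  rewrite scalerDr !scalerA mulrC; congr (_ + _ *: _).
  by field; rewrite !gt_eqF.
apply: cY => //; last exact: IH.
by rewrite divr_ge0 ?(ltW kt0)//= ler_pdivrMr ?mul1r ?lerDl ?(ltW t0).
Qed.

Lemma compact_simplex : compact simplex.
Proof.
apply: bounded_closed_compact.
  exists 1; split; first exact: num_real.
  move=> M M1 l [l0 l1]; apply: ltW; apply: le_lt_trans M1.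
  rewrite /Num.norm/= mx_normrE; apply: bigmax_le => // -[i k] _ /=.
  rewrite (ord1 i) ger0_norm// -l1 (bigD1 k)//= lerDl.
  by apply: sumr_ge0.
rewrite (_ : simplex = (\bigcap_k ((fun l => l ord0 k) @^-1` [set r | 0 <= r]))
    `&` ((fun l => \sum_k l ord0 k) @^-1` [set 1])); last first.
  apply/seteqP; split=> l [l0 l1]; split=> // k; last exact: l0.
  by move=> _; exact: l0.
apply: closedI.
  apply: closed_bigI => k _; apply: preimage_closed; last exact: closed_ge.
  by move=> l _; exact: coord_continuous.
apply: preimage_closed => [l _|]; last exact: closed_eq.
apply: continuous_big => [|k _]; first exact: add_continuous.
exact: coord_continuous.
Qed.

(* Strict inequalities, so that measurability reduces to rational thresholds. *)
Definition mm_hull (e : R) : set 'rV[R]_d := [set z | forall i j,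
  exists l, [/\ simplex l, z ord0 i < mixture l ord0 i + e &
                mixture l ord0 j < z ord0 j + e]].

(** [mixture] is affine in the weights, so the witnesses for [u] and [v] combine with the same
    coefficient [t]. *)
Lemma convex_mm_hull e : convex_set (mm_hull e).
Proof.
apply/convex_set_combP => u v t t01 Hu Hv i j.
have [l [sl u1 u2]] := Hu i j; have [l' [sl' v1 v2]] := Hv i j.
exists (t *: l + (1 - t) *: l'); rewrite mixture_comb !mxE.
split; first exact: simplex_comb.
  by apply: lt_le_trans (comb_lt t01 u1 v1) _; lra.
by apply: lt_le_trans (comb_lt t01 u2 v2) _; lra.
Qed.

(** For the minimum, the witness comes from whichever point is smaller in coordinate [j], since
    passing to the minimum only relaxes the condition at [i]. The maximum is handled dually through
    coordinate [i]. *)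
Lemma minmax_mm_hull e : minmax_closed (mm_hull e).
Proof.
move=> u v Hu Hv; split=> i j; rewrite !mxE.
  have [uv|uv] := leP (u ord0 j) (v ord0 j).
    have [l [sl u1 u2]] := Hu i j; exists l; split=> //.
    by apply: le_lt_trans u1; rewrite ge_min lexx.
  have [l [sl u1 u2]] := Hv i j; exists l; split=> //.
  by apply: le_lt_trans u1; rewrite ge_min lexx orbT.
have [uv|uv] := leP (u ord0 i) (v ord0 i).
  have [l [sl u1 u2]] := Hv i j; exists l; split=> //.
  by apply: (lt_le_trans u2); rewrite lerD2r le_max lexx orbT.
have [l [sl u1 u2]] := Hu i j; exists l; split=> //.
by apply: (lt_le_trans u2); rewrite lerD2r le_max lexx.
Qed.

Lemma measurable_mm_hull e : measurable (mm_hull e).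
Proof.
(* The union over [l] is uncountable, but [l] enters only through two numbers; rational thresholds
   [p] and [q] between these and the coordinates of [z] make the union countable. *)
pose G i j (p : rat) (q : rat) : set 'rV[R]_d :=
  if `[< exists l, [/\ simplex l, ratr p < mixture l ord0 i + e &
                mixture l ord0 j - e < ratr q] >]
  then [set z | z ord0 i < ratr p] `&` [set z | ratr q < z ord0 j] else set0.
have -> : mm_hull e = \bigcap_(i in [set: 'I_d]) \bigcap_(j in [set: 'I_d])
    \bigcup_p \bigcup_q G i j p q.
  apply/seteqP; split=> z.
    move=> Hz i _ j _; have [l [sl z1 z2]] := Hz i j.
    have [p] := rat_in_itvoo z1; rewrite in_itv/= => /andP[p1 p2].
    rewrite -ltrBlDr in z2.
    have [q] := rat_in_itvoo z2; rewrite in_itv/= => /andP[q1 q2].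
    exists p => //; exists q => //; rewrite /G; case: asboolP => //.
    by case; exists l.
  move=> Hz i j; have [p _ [q _]] := Hz i I j I.
  rewrite /G; case: asboolP => // -[l [sl l1 l2]] [zp zq].
  exists l; split=> //; first exact: lt_trans l1.
  by rewrite -ltrBlDr; exact: lt_trans zq.
apply: fin_bigcap_measurable; first exact: finite_finset.
move=> i _; apply: fin_bigcap_measurable; first exact: finite_finset.
move=> j _; apply: bigcupT_measurable_rat => p; apply: bigcupT_measurable_rat => q.
rewrite /G; case: asboolP => _; last exact: measurable0.
apply: measurableI.
  exact: (measurable_ltr_set _ (@measurable_coor R d i)).
exact: (measurable_gtr_set _ (@measurable_coor R d j)).
Qed.

Lemma range_mm_hull e : 0 < e -> range x `<=` mm_hull e.
Proof.
move=> e0 _ [k _ <-] i j; exists (delta_mx ord0 k).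
by rewrite mixture_vertex !ltrDl; split=> //; exact: simplex_vertex.
Qed.

Lemma mm_hull_near e e' y z : mm_hull e y ->
  (forall i, `|y ord0 i - z ord0 i| <= e') -> mm_hull (e + e') z.
Proof.
move=> Hy yz i j; have [l [sl y1 y2]] := Hy i j; exists l; split=> //.
  by have := yz i; rewrite ler_norml => /andP[]; lra.
by have := yz j; rewrite ler_norml => /andP[]; lra.
Qed.

Lemma mm_hull_ltr e z i : mm_hull e z ->
  exists k, z ord0 i < x k ord0 i + e.
Proof.
move=> /(_ i i) [l [[l0 l1] z1 _]]; apply: contrapT => /forallNP H.
have : mixture l ord0 i <= z ord0 i - e.
  rewrite /mixture summxE.
  apply: (@le_trans _ _ (\sum_k l ord0 k * (z ord0 i - e))).
    apply: ler_sum => k _; rewrite mxE ler_wpM2l//.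
    by have /negP := H k; rewrite -leNgt; lra.
  by rewrite -mulr_suml l1 mul1r.
lra.
Qed.

Lemma mm_hull_gtr e z i : mm_hull e z ->
  exists k, x k ord0 i - e < z ord0 i.
Proof.
move=> /(_ i i) [l [[l0 l1] _ z1]]; apply: contrapT => /forallNP H.
have : z ord0 i + e <= mixture l ord0 i.
  rewrite /mixture summxE.
  apply: (@le_trans _ _ (\sum_k l ord0 k * (z ord0 i + e))).
    by rewrite -mulr_suml l1 mul1r.
  apply: ler_sum => k _; rewrite mxE ler_wpM2l//.
  by have /negP := H k; rewrite -leNgt; lra.
lra.
Qed.

(** Compactness of the simplex turns the approximate witnesses, one for each [m], into an exact one
    for the pair [(i, j)], as the pairwise criterion requires. *)
Lemma mm_hull_min (Y : set 'rV[R]_d) : (0 < n)%N -> minmax_closed Y ->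
  convex_set Y -> range x `<=` Y ->
  \bigcap_m mm_hull m.+1%:R^-1 `<=` Y.
Proof.
move=> n0 mY cY xY z Hz; apply: minmax_closed_pairwise => //.
  by exists (x (Ordinal n0)); apply: xY; exists (Ordinal n0).
move=> i j.
(* [phi l] is the worst violation by [mixture l] of the two required inequalities. Its minimum is at
   most 0, because the relaxed hulls provide values below every $1/(m+1)$. *)
pose phi l := Num.max (z ord0 i - mixture l ord0 i) (mixture l ord0 j - z ord0 j).
have coor_cont k : continuous (fun l => mixture l ord0 k).
  rewrite /mixture (_ : (fun l => _) = fun l : 'rV[R]_n => \sum_a l ord0 a * x a ord0 k); last first.
    by apply/funext => l'; rewrite summxE; apply: eq_bigr => a _; rewrite mxE.
  apply: continuous_big => [|a _ l]; first exact: add_continuous.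
  exact: (@cvgMr_tmp _ _ (nbhs l) _ _ _ _ (@coord_continuous R 1 n ord0 a l)).
have cphi : continuous phi.
  move=> l; apply: (@continuous_max _ _ (fun l => z ord0 i - mixture l ord0 i)
     (fun l => mixture l ord0 j - z ord0 j)).
    by apply: continuousB; [exact: cst_continuous|exact: coor_cont].
  by apply: continuousB; [exact: coor_cont|exact: cst_continuous].
have [] := @compact_EVT_min _ R phi simplex _ compact_simplex.
- by exists (delta_mx ord0 (Ordinal n0)); exact: simplex_vertex.
- exact: continuous_subspaceT.
move=> l /set_mem sl minl; exists (mixture l).
have : phi l <= 0.
  rewrite leNgt; apply/negP => phi0.
  have [m /= mphi] : exists m, m.+1%:R^-1 < phi l.
    have [m _ /(_ m (leqnn m))] := near_infty_natSinv_lt (PosNum phi0).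
    by exists m.
  have [l' [sl' l1 l2]] := Hz m I i j.
  have := minl l' (mem_set sl').
  apply/negP; rewrite -ltNge; apply: lt_trans mphi.
  by rewrite /phi gt_max; apply/andP; rewrite !ltrBlDl.
rewrite /phi ge_max => /andP[]; rewrite subr_le0 => h1; rewrite subr_le0 => h2.
by split=> //; exact: convex_mixture.
Qed.

End minmax_hull.

(** * Relaxed $L^\natural$-hulls of the sample *)

Section Lnat_hull.
Variables (R : realType) (d n : nat) (x : 'I_n -> 'rV[R]_d).
Implicit Types (u v y z : 'rV[R]_d).

(** A finite family attains its maximum, so a bound with arbitrarily small slack holds with none. *)
Lemma below_family (b : 'I_n -> R) (a : R) :
  (forall m : nat, exists k, a < b k + m.+1%:R^-1) -> exists k, a <= b k.
Proof.
move=> H; have [k0 _] := H 0%N.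
have [/= k _ kmax] := Order.TotalTheory.arg_maxP b (erefl (predT k0)).
exists k; rewrite leNgt; apply/negP; rewrite -subr_gt0 => ab.
have [m _ /(_ m (leqnn m))/= mab] := near_infty_natSinv_lt (PosNum ab).
have [k' k'1] := H m.
rewrite ltrBrDl in mab.
have := lt_trans (lt_le_trans k'1 (lerD (kmax k' isT) (lexx _))) mab.
by rewrite ltxx.
Qed.

(** The index with the larger value of [b] serves both bounds. *)
Lemma comb_below_family (b : 'I_n -> R) (t a a' e : R) : 0 <= t <= 1 ->
  (exists k, a < b k + e) -> (exists k, a' < b k + e) ->
  exists k, t * a + (1 - t) * a' < b k + e.
Proof.
move=> t01 [k1 ab] [k2 ab'].
have [b12|b21] := leP (b k1) (b k2).
  have ab2 : a < b k2 + e by apply: lt_le_trans ab _; rewrite lerD2r.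
  exists k2; apply: lt_le_trans (comb_lt t01 ab2 ab') _.
  by rewrite -mulrDl subrKC mul1r.
have ab1 : a' < b k1 + e by apply: (lt_trans ab'); rewrite ltrD2r.
exists k1; apply: lt_le_trans (comb_lt t01 ab ab1) _.
by rewrite -mulrDl subrKC mul1r.
Qed.

(* Strict version, relaxed by e, of the inequalities z_i <= max_k x_k,i,
   z_i >= min_k x_k,i and z_i - z_j <= max_k (x_k,i - x_k,j) defining Lext. *)
Definition Lnat_hull (e : R) : set 'rV[R]_d := [set z | forall i j,
  [/\ exists k, z ord0 i < x k ord0 i + e,
      exists k, - z ord0 i < - x k ord0 i + e &
      exists k, z ord0 i - z ord0 j < x k ord0 i - x k ord0 j + e]].

Lemma convex_Lnat_hull e : convex_set (Lnat_hull e).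
Proof.
apply/convex_set_combP => u v t t01 Hu Hv i j.
have [u1 u2 u3] := Hu i j; have [v1 v2 v3] := Hv i j.
rewrite !mxE; split.
- exact: (comb_below_family t01 u1 v1).
- by have [k] := comb_below_family t01 u2 v2; exists k; lra.
- by have [k] := comb_below_family t01 u3 v3; exists k; lra.
Qed.

(** The shift [a] cancels in coordinate differences: the difference bound is inherited from the
    point attaining the minimum at [j], respectively the maximum at [i]. The one-sided bounds
    survive because [a] is nonnegative. *)
Lemma Lnat_Lnat_hull e : Lnat_convex (Lnat_hull e).
Proof.
move=> u v Hu Hv a a0; split=> i j; rewrite !mxE;
  have [[k1 u1] [k2 u2] [k3 u3]] := Hu i j;
  have [[h1 v1] [h2 v2] [h3 v3]] := Hv i j; split.
- by exists h1; apply: le_lt_trans v1; rewrite ge_min lexx orbT.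
- by case: (leP (u ord0 i + a) (v ord0 i)) => _; [exists k2; lra|exists h2].
- case: (leP (u ord0 j + a) (v ord0 j)) => _.
    exists k3; apply: le_lt_trans u3.
    by have : Num.min (u ord0 i + a) (v ord0 i) <= u ord0 i + a;
      [rewrite ge_min lexx|lra].
  exists h3; apply: le_lt_trans v3.
  by have : Num.min (u ord0 i + a) (v ord0 i) <= v ord0 i;
    [rewrite ge_min lexx orbT|lra].
- by case: (leP (u ord0 i) (v ord0 i - a)) => _; [exists h1; lra|exists k1].
- exists k2; apply: le_lt_trans u2; rewrite lerN2 le_max lexx.
  by [].
- case: (leP (u ord0 i) (v ord0 i - a)) => _.
    exists h3; apply: le_lt_trans v3.
    by have : v ord0 j - a <= Num.max (u ord0 j) (v ord0 j - a);
      [rewrite le_max lexx orbT|lra].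
  exists k3; apply: le_lt_trans u3.
  by have : u ord0 j <= Num.max (u ord0 j) (v ord0 j - a);
    [rewrite le_max lexx|lra].
Qed.

Lemma measurable_Lnat_hull e : measurable (Lnat_hull e).
Proof.
pose A i := \bigcup_(k in [set: 'I_n]) [set z : 'rV[R]_d | z ord0 i < x k ord0 i + e].
pose B i := \bigcup_(k in [set: 'I_n]) [set z : 'rV[R]_d | x k ord0 i - e < z ord0 i].
pose C i j := \bigcup_(k in [set: 'I_n]) [set z : 'rV[R]_d |
  z ord0 i - z ord0 j < x k ord0 i - x k ord0 j + e].
have -> : Lnat_hull e = \bigcap_(i in [set: 'I_d]) \bigcap_(j in [set: 'I_d])
    (A i `&` B i `&` C i j).
  apply/seteqP; split=> z Hz i.
    move=> _ j _; have [[k1 u1] [k2 u2] [k3 u3]] := Hz i j; split; [split|].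
    - by exists k1.
    - by exists k2 => //=; lra.
    - by exists k3.
  move=> j; have [[[k1 _ u1] [k2 _ /= u2]] [k3 _ u3]] := Hz i I j I; split.
  - by exists k1.
  - by exists k2; lra.
  - by exists k3.
apply: fin_bigcap_measurable; first exact: finite_finset.
move=> i _; apply: fin_bigcap_measurable; first exact: finite_finset.
move=> j _; apply: measurableI; first apply: measurableI.
- apply: fin_bigcup_measurable; first exact: finite_finset.
  by move=> k _; exact: (measurable_ltr_set _ (@measurable_coor R d i)).
- apply: fin_bigcup_measurable; first exact: finite_finset.
  by move=> k _; exact: (measurable_gtr_set _ (@measurable_coor R d i)).
- apply: fin_bigcup_measurable; first exact: finite_finset.
  move=> k _; apply: (measurable_ltr_set (f := fun z : 'rV[R]_d => _)).
  by apply: measurable_funB; exact: measurable_coor.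
Qed.

Lemma range_Lnat_hull e : 0 < e -> range x `<=` Lnat_hull e.
Proof. by move=> e0 _ [k _ <-] i j; split; exists k; rewrite ltrDl. Qed.

(** A difference of two coordinates can move by $2e'$, whence the doubled slack. *)
Lemma Lnat_hull_near e e' y z : Lnat_hull e y ->
  (forall i, `|y ord0 i - z ord0 i| <= e') -> Lnat_hull (e + e' *+ 2) z.
Proof.
move=> Hy yz i j; have [[k1 u1] [k2 u2] [k3 u3]] := Hy i j.
have := yz i; have := yz j; rewrite !ler_norml => /andP[? ?] /andP[? ?].
by split; [exists k1|exists k2|exists k3]; lra.
Qed.

(** In the limit the three inequalities hold without slack, each at some sample point. For the pair
    [(i, j)], the point [x k3] has a large enough gap between the two coordinates; if its level is
    wrong, it is shifted along $\mathbf 1$ and combined with [x k1] or [x k2]. *)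
Lemma Lnat_hull_min (Y : set 'rV[R]_d) : (0 < n)%N -> Lnat_convex Y ->
  range x `<=` Y -> \bigcap_m Lnat_hull m.+1%:R^-1 `<=` Y.
Proof.
move=> n0 LY xY z Hz.
have xk k : Y (x k) by apply: xY; exists k.
apply: minmax_closed_pairwise; [by exists (x (Ordinal n0))|exact: Lnat_minmax|].
move=> i j.
have [k1 z1] : exists k, z ord0 i <= x k ord0 i.
  by apply: below_family => m; have [] := Hz m I i j.
have [k2] : exists k, - z ord0 j <= - x k ord0 j.
  by apply: (@below_family (fun k => - x k ord0 j)) => m; have [] := Hz m I j j.
rewrite lerN2 => z2.
have [k3 z3] : exists k, z ord0 i - z ord0 j <= x k ord0 i - x k ord0 j.
  by apply: (@below_family (fun k => x k ord0 i - x k ord0 j)) => m;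
    have [] := Hz m I i j.
have [zi|zi] := leP (z ord0 i) (x k3 ord0 i).
  have [zj|zj] := leP (x k3 ord0 j) (z ord0 j); first by exists (x k3).
  (* Lowering [x k3] by this amount puts coordinate [j] at [z ord0 j] and keeps coordinate [i] at
     least [z ord0 i]; the maximum with [x k2] does no harm at [j]. *)
  have a0 : 0 <= x k3 ord0 j - z ord0 j by lra.
  have [_ Yu] := LY (x k2) (x k3) (xk k2) (xk k3) _ a0.
  eexists; split; first exact: Yu.
    by rewrite !mxE le_max; apply/orP; right; lra.
  by rewrite !mxE ge_max z2/=; lra.
(* Dually, [x k3] is raised until coordinate [i] reaches [z ord0 i], and the minimum with [x k1] is
   taken. *)
have a0 : 0 <= z ord0 i - x k3 ord0 i by lra.
have [Yu _] := LY (x k3) (x k1) (xk k3) (xk k1) _ a0.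
eexists; split; first exact: Yu.
  by rewrite !mxE le_min z1 andbT; lra.
by rewrite !mxE ge_min; apply/orP; left; lra.
Qed.

End Lnat_hull.

(** * Lebesgue measure under positive scalings and translations *)

Section affine_image.
Variable R : realType.

Let aff (s c : R) : measurableTypeR R -> measurableTypeR R := fun a => s * a + c.

Let measurable_aff s c : measurable_fun setT (aff s c).
Proof.
apply: (@measurable_funD _ _ _ _ (fun a : R => s * a) (cst c)).
  exact: measurable_funM.
exact: measurable_cst.
Qed.

(** By uniqueness of Lebesgue measure: [s] times the image measure under the affine map gives
    half-open intervals their length. *)
Lemma lebesgue_measure_affine (s c : R) (s0 : 0 < s) (A : set R) :
  measurable A ->
  lebesgue_measure ((fun a => s * a + c) @^-1` A) =
  (s^-1%:E * lebesgue_measure A)%E.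
Proof.
move=> mA; have s0' : 0 <= s by exact: ltW.
have H := @lebesgue_measure_unique R
  (mscale (NngNum s0') (pushforward lebesgue_measure (aff s c))).
rewrite (H (measurable_aff s c) _ A mA).
  by rewrite /mscale/= muleA -EFinM mulVf ?gt_eqF// mul1e.
move=> _ [[a b] _ <-].
transitivity (s%:E * lebesgue_measure (aff s c @^-1` [set` `]a, b]]))%E; last by [].
rewrite [X in (_ * lebesgue_measure X)%E](_ : _ = `](a - c) / s, (b - c) / s]%classic); last first.
  apply/seteqP; split=> r /=; rewrite /aff !in_itv/=.
    by rewrite ltr_pdivrMr// ler_pdivlMr//; move=> /andP[? ?]; apply/andP; split; nra.
  by rewrite ltr_pdivrMr// ler_pdivlMr//; move=> /andP[? ?]; apply/andP; split; nra.
rewrite !lebesgue_measure_itv/= !lte_fin ltr_pM2r ?invr_gt0// ltrD2r.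
case: ifP => _; last by rewrite mule0.
by rewrite -EFinM; congr EFin; field; rewrite gt_eqF.
Qed.

Lemma ge0_integral_affine (s c : R) (s0 : 0 < s) (f : measurableTypeR R -> \bar R) :
  measurable_fun setT f -> (forall a, 0 <= f a)%E ->
  (\int[lebesgue_measure]_a f (s * a + c)%R =
   s^-1%:E * \int[lebesgue_measure]_a f a)%E.
Proof.
move=> mf f0; have s0' : 0 <= s^-1 by rewrite invr_ge0 ltW.
transitivity (\int[pushforward lebesgue_measure (aff s c)]_a f a)%E.
  by rewrite ge0_integral_pushforward// preimage_setT.
rewrite -(@ge0_integral_mscale _ _ _ _ _ _ (NngNum s0'))//.
apply: eq_measure_integral => A mA _.
exact: lebesgue_measure_affine.
Qed.

Lemma measurable_rV_affine (d : nat) (s : R) (c : 'rV[R]_d) :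
  measurable_fun setT (fun v : 'rV[R]_d => s *: v + c).
Proof.
apply/measurable_fun_coorP => i.
rewrite (_ : (fun v => _) = fun v : 'rV[R]_d => s * v ord0 i + c ord0 i).
  exact: (measurableT_comp (measurable_aff s (c ord0 i)) (@measurable_coor R d i)).
by apply/funext => v; rewrite !mxE.
Qed.

(** Induction on the dimension, slicing along the first coordinate: the slices contribute the power
    [d] of [s^-1], and the outer integral one more factor. *)
Lemma lebesgue_rV_affine (d : nat) (s : R) (c : 'rV[R]_d) (A : set 'rV[R]_d) :
  0 < s -> measurable A ->
  lebesgue_rV R d ((fun v => s *: v + c) @^-1` A) =
  ((s^-1 ^+ d)%:E * lebesgue_rV R d A)%E.
Proof.
move=> s0; elim: d c A => [|d IH] c A mA.
  rewrite expr0 mul1e /=; congr (dirac _ _).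
  by apply/seteqP; split=> v /=; rewrite (thinmx0 (_ + _)) (thinmx0 v).
pose B := @consrV R d @^-1` A.
have mB : measurable B by rewrite -[B]setTI; exact: measurable_consrV.
rewrite /= /lebesgue_step /pushforward -/B.
pose c' : 'rV[R]_d := \row_j c ord0 (lift ord0 j).
rewrite /product_measure1.
under eq_integral => a _.
  rewrite /= (_ : xsection _ a = (fun v => s *: v + c') @^-1`
      xsection B (s * a + c ord0 ord0)); last first.
    apply/seteqP; split=> v; rewrite /= !xsectionE /= /B /=;
      suff -> : s *: consrV (a, v) + c =
         consrV (s * a + c ord0 ord0, s *: v + c') by [];
      by apply/rowP => i; rewrite !mxE; case: unliftP => [j ->|->] /=;
        rewrite ?mxE.
  rewrite IH; last exact: measurable_xsection.
  over.
rewrite ge0_integralZl//=; last 2 first.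
- exact: (measurableT_comp (measurable_fun_xsection (lebesgue_rV R d) mB)
    (measurable_aff s (c ord0 ord0))).
- by rewrite lee_fin exprn_ge0// invr_ge0 ltW.
rewrite (ge0_integral_affine _ s0 (f := fun a => lebesgue_rV R d (xsection B a)))//.
  by rewrite muleA -EFinM exprSr.
exact: measurable_fun_xsection.
Qed.

End affine_image.

(** * Supports and rescaled restrictions of shape-constrained functions *)

Section support_shape.
Variables (R : realType) (d : nat) (f : 'rV[R]_d -> R).
Hypothesis f0 : forall v, 0 <= f v.

Lemma convex_support : log_concave f -> convex_set [set z | 0 < f z].
Proof.
move=> lf; apply/convex_set_combP => u v t t01 /= fu fv.
by apply: lt_le_trans (lf u v t t01); rewrite mulr_gt0// powR_gt0.
Qed.

Let mul_support (a b u v : 'rV[R]_d) : f u * f v <= f a * f b ->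
  0 < f u -> 0 < f v -> 0 < f a /\ 0 < f b.
Proof.
move=> le fu fv; have := lt_le_trans (mulr_gt0 fu fv) le.
rewrite !lt_neqAle !f0 !andbT !(eq_sym 0) mulf_eq0 negb_or.
by move=> /andP[/andP[]].
Qed.

Lemma minmax_support : MTP2 f -> minmax_closed [set z | 0 < f z].
Proof. by move=> mf u v /= fu fv; exact: mul_support (mf u v) fu fv. Qed.

Lemma Lnat_support : LLC f -> Lnat_convex [set z | 0 < f z].
Proof. by move=> mf u v /= fu fv a a0; exact: mul_support (mf a u v a0) fu fv. Qed.

End support_shape.

Section restriction.
Variables (R : realType) (d : nat).
Implicit Types (f : 'rV[R]_d -> R) (Y : set 'rV[R]_d).

Definition scaled_restriction (c : R) f Y : 'rV[R]_d -> R :=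
  fun z => c * (f z * \1_Y z).

Variables (c : R) (f : 'rV[R]_d -> R) (Y : set 'rV[R]_d).
Hypotheses (c0 : 0 <= c) (f0 : forall v, 0 <= f v).

Let g := scaled_restriction c f Y.

Lemma scaled_restrictionE z : Y z -> g z = c * f z.
Proof. by move=> Yz; rewrite /g/scaled_restriction indicE mem_set// mulr1. Qed.

Lemma scaled_restriction0 z : ~ Y z -> g z = 0.
Proof. by move=> Yz; rewrite /g/scaled_restriction indicE memNset// !mulr0. Qed.

Lemma scaled_restriction_ge0 z : 0 <= g z.
Proof. by rewrite /g/scaled_restriction !mulr_ge0// indicE ler0n. Qed.

Lemma log_concave_restriction : convex_set Y -> log_concave f -> log_concave g.
Proof.
move=> /convex_set_combP cY lf u v t t01.
have [Yu|nYu] := pselect (Y u); last first.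
  (* Since $0^0 = 1$, the endpoint is treated apart: at [t = 0] the left side is [g v], not 0. *)
  rewrite scaled_restriction0//; have [->|t0] := eqVneq t 0.
    by rewrite powRr0 mul1r subr0 scale0r add0r scale1r powRr1// scaled_restriction_ge0.
  by rewrite powR0// mul0r scaled_restriction_ge0.
have [Yv|nYv] := pselect (Y v); last first.
  rewrite [g v]scaled_restriction0//; have [->|t1] := eqVneq t 1.
    by rewrite subrr powRr0 mulr1 scale0r addr0 scale1r powRr1// scaled_restriction_ge0.
  by rewrite powR0 ?mulr0 ?scaled_restriction_ge0// subr_eq0 eq_sym.
rewrite !scaled_restrictionE//; last exact: cY.
(* The factors $c^t$ and $c^{1-t}$ multiply to [c]. *)
rewrite !powRM// mulrACA -powRD ?subrKC ?oner_eq0// powRr1//.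
by rewrite ler_wpM2l//; exact: lf.
Qed.

Let restriction_mul (a b u v : 'rV[R]_d) : (Y u -> Y v -> Y a /\ Y b) ->
  f u * f v <= f a * f b -> g u * g v <= g a * g b.
Proof.
move=> Yab le.
have [Yu|nYu] := pselect (Y u); last first.
  by rewrite scaled_restriction0// mul0r mulr_ge0// scaled_restriction_ge0.
have [Yv|nYv] := pselect (Y v); last first.
  by rewrite [g v]scaled_restriction0// mulr0 mulr_ge0// scaled_restriction_ge0.
have [Ya Yb] := Yab Yu Yv; rewrite !scaled_restrictionE//.
by rewrite mulrACA [leRHS]mulrACA ler_wpM2l// mulr_ge0.
Qed.

Lemma MTP2_restriction : minmax_closed Y -> MTP2 f -> MTP2 g.
Proof.
move=> mY mf u v; apply: restriction_mul (mf u v).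
by move=> Yu Yv; exact: mY.
Qed.

Lemma LLC_restriction : Lnat_convex Y -> LLC f -> LLC g.
Proof.
move=> LY lf a u v a0; apply: restriction_mul (lf a u v a0).
by move=> Yu Yv; exact: LY.
Qed.

End restriction.

(** A vanishing integral would make [f] zero almost everywhere on [D]; as [f] is positive there, [D]
    would be negligible. *)
Lemma integral_gt0_measure (dT : measure_display) (T : measurableType dT)
    (R : realType) (mu : {measure set T -> \bar R}) (D : set T) (f : T -> R) :
  measurable D -> measurable_fun setT f -> (forall t, 0 <= f t) ->
  (forall t, D t -> 0 < f t) -> (0 < mu D)%E ->
  (0 < \int[mu]_(t in D) (f t)%:E)%E.
Proof.
move=> mD mf f0 fD muD; rewrite lt_neqAle integral_ge0 ?andbT; last first.
  by move=> t _; rewrite lee_fin.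
apply/negP => /eqP intf.
have mf' : measurable_fun D (EFin \o f).
  by apply/measurable_EFinP; exact: measurable_funS mf.
have : (\int[mu]_(t in D) `|(EFin \o f) t| = 0)%E.
  by rewrite intf; apply: eq_integral => t _ /=; rewrite ger0_norm.
move/(ae_eq_integral_abs _ mD mf') => [N [mN N0 DN]].
move: muD; apply/negP; rewrite -leNgt -N0 le_measure ?inE// => t Dt.
apply: DN => /= /(_ Dt) [ft]; move: (fD t Dt); rewrite ft ltxx//.
Qed.

Lemma sum1_size_gt0 (R : nzRingType) (n : nat) (w : 'I_n -> R) :
  \sum_(k < n) w k = 1 -> (0 < n)%N.
Proof.
by case: n w => // w /eqP; rewrite big_ord0 eq_sym oner_eq0.
Qed.

(** * Log-likelihood and its behaviour under rescaled restriction *)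

Section loglik.
Variables (R : realType) (d n : nat) (x : 'I_n -> 'rV[R]_d) (w : 'I_n -> R).
Hypotheses (w_gt0 : forall k, 0 < w k) (w_sum : \sum_k w k = 1).
Implicit Types f : 'rV[R]_d -> R.

Lemma loglik_fin f : (forall k, 0 < f (x k)) ->
  loglik x w f = (\sum_k w k * ln (f (x k)))%:E.
Proof.
move=> fx; rewrite /loglik -sumEFin; apply: eq_bigr => k _.
by rewrite lne_EFin.
Qed.

(** The weights being positive, a zero of [f] at a single sample point drives the whole sum to
    [-oo]. *)
Lemma loglik_gtNy f : (-oo < loglik x w f)%E -> forall k, 0 < f (x k).
Proof.
move=> lf k; rewrite ltNge; apply/negP => fk.
move: lf; rewrite ltNye => /eqP; apply; apply/esum_eqNyP; exists k => //.
by rewrite le0_lneNy ?lee_fin// gt0_muleNy// lte_fin.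
Qed.

(** As the weights sum to 1, rescaling by [c] adds exactly [ln c]. *)
Lemma loglik_scaled_restriction (c : R) f Y : 0 < c -> (forall k, 0 < f (x k)) ->
  range x `<=` Y ->
  loglik x w (scaled_restriction c f Y) =
  (ln c + \sum_k w k * ln (f (x k)))%:E.
Proof.
move=> c0 fx xY; have gx k : scaled_restriction c f Y (x k) = c * f (x k).
  by rewrite scaled_restrictionE//; apply: xY; exists k.
rewrite loglik_fin => [|k]; last by rewrite gx mulr_gt0.
congr EFin; under eq_bigr do rewrite gx lnM ?posrE// mulrDr.
by rewrite big_split/= -mulr_suml w_sum mul1r.
Qed.

End loglik.

Lemma density_scaled_restriction (R : realType) (d : nat) (f : 'rV[R]_d -> R)
    (Y : set 'rV[R]_d) (I : R) :
  measurable_fun setT f -> (forall z, 0 <= f z) -> measurable Y -> 0 < I ->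
  (\int[lebesgue_rV R d]_(z in Y) (f z)%:E = I%:E)%E ->
  density (scaled_restriction I^-1 f Y).
Proof.
move=> mf f0 mY I0 intf; have mg : measurable_fun setT (fun z => f z * \1_Y z).
  by apply: measurable_funM => //; exact: measurable_indic.
split; first by apply: measurable_funM => //; exact: measurable_cst.
  by move=> z; rewrite scaled_restriction_ge0// invr_ge0 ltW.
rewrite /scaled_restriction; under eq_integral do rewrite EFinM.
rewrite ge0_integralZl//=; last 3 first.
- exact/measurable_EFinP.
- by move=> z _; rewrite lee_fin mulr_ge0// indicE ler0n.
- by rewrite lee_fin invr_ge0 ltW.
rewrite (_ : (\int[_]_z _)%E = I%:E); first by rewrite -EFinM mulVf// gt_eqF.
rewrite -intf [RHS]integral_mkcond; apply: eq_integral => z _.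
by rewrite epatch_indic /= EFinM.
Qed.

(** * Support of the MLE under an abstract shape constraint *)

Section MLE_support.
Variables (R : realType) (d n : nat) (x : 'I_n -> 'rV[R]_d) (w : 'I_n -> R).
Hypotheses (w_gt0 : forall k, 0 < w k) (w_sum : \sum_k w k = 1).

(** [Q] stands for [MTP2] or [LLC] and [C] for the matching closedness of sets, so that one argument
    covers both estimators. *)
Variables (Q : ('rV[R]_d -> R) -> Prop) (C : set 'rV[R]_d -> Prop).
Hypothesis Q1 : Q (cst 1).
Hypothesis Q_restriction : forall c f Y, 0 <= c -> (forall z, 0 <= f z) -> C Y ->
  Q f -> Q (scaled_restriction c f Y).
Hypothesis Q_support : forall f, (forall z, 0 <= f z) -> Q f ->
  C [set z | 0 < f z].
Hypothesis C_bigcap : forall F : nat -> set 'rV[R]_d, (forall m, C (F m)) ->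
  C (\bigcap_m F m).

(** [K m] stands for the relaxed hull with slack $1/(m+1)$; [K_near] gives it a uniform margin
    around the exact hull [Koo]. *)
Variable K : nat -> set 'rV[R]_d.
Let Koo := \bigcap_m K m.
Hypotheses (K_convex : forall m, convex_set (K m)) (K_C : forall m, C (K m)).
Hypotheses (K_meas : forall m, measurable (K m)) (K_sub : nonincreasing_seq K).
Hypothesis K_range : forall m, range x `<=` K m.
Hypothesis K_bounded : exists2 b : R, 0 <= b & forall z, K 0%N z -> forall i, `|z ord0 i| <= b.
Hypothesis K_near : forall m, exists2 e : R, 0 < e & forall y z : 'rV[R]_d, Koo y ->
  (forall i, `|y ord0 i - z ord0 i| <= e) -> K m z.
Hypothesis K_min : forall Y, C Y -> convex_set Y -> range x `<=` Y -> Koo `<=` Y.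

Let mu := lebesgue_rV R d.
Let F : set ('rV[R]_d -> R) := [set g | [/\ density g, log_concave g & Q g]].

Let n_gt0 : (0 < n)%N. Proof. exact: sum1_size_gt0 w_sum. Qed.
Let Koo_x : range x `<=` Koo. Proof. by move=> z xz m _; exact: K_range. Qed.
Let Koo_meas : measurable Koo. Proof. exact: bigcapT_measurable. Qed.
Let Koo_C : C Koo. Proof. exact: C_bigcap. Qed.
Let Koo_convex : convex_set Koo. Proof. exact: convex_bigcap. Qed.

Let log_concave1 : log_concave (cst 1 : 'rV[R]_d -> R).
Proof. by move=> u v l _; rewrite /= !powR1 mulr1. Qed.

Let measurable_box (a b : 'rV[R]_d) :
  measurable [set z : 'rV[R]_d | forall i, z ord0 i \in `[a ord0 i, b ord0 i]].
Proof.
rewrite (_ : [set z | _] = \bigcap_(i in [set: 'I_d])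
   (setT `&` (fun z : 'rV[R]_d => z ord0 i) @^-1` `[a ord0 i, b ord0 i]%classic)).
  apply: fin_bigcap_measurable; first exact: finite_finset.
  by move=> i _; apply: measurable_coor => //; exact: measurable_itv.
apply/seteqP; split=> z Hz i; last by have [] := Hz i I.
by move=> _; split=> //; exact: Hz.
Qed.

Let mu_K0 : (mu (K 0%N) < +oo)%E.
Proof.
have [b b0 Kb] := K_bounded.
pose lo : 'rV[R]_d := const_mx (- b); pose hi : 'rV[R]_d := const_mx b.
apply: (@le_lt_trans _ _
    (mu [set z | forall i, z ord0 i \in `[lo ord0 i, hi ord0 i]])).
  rewrite le_measure ?inE//; first exact: measurable_box.
  by move=> z /Kb zb i; rewrite in_itv/= !mxE -ler_norml; exact: zb.
rewrite /mu lebesgue_rV_box ?ltry// => i; rewrite !mxE.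
by rewrite -subr_ge0 opprK addr_ge0.
Qed.

Let mu_K_fin m : mu (K m) \is a fin_num.
Proof.
rewrite ge0_fin_numE//; apply: le_lt_trans mu_K0.
by rewrite le_measure ?inE//; apply/subsetPset; exact: K_sub.
Qed.

Let mu_K_gt0 m : (0 < mu (K m))%E.
Proof.
have [e e0 He] := K_near m.
pose p := x (Ordinal n_gt0).
(* The cube of half-side [e] around a sample point lies in [K m]. *)
pose lo := p - const_mx e; pose hi := p + const_mx e.
apply: (@lt_le_trans _ _
    (mu [set z | forall i, z ord0 i \in `[lo ord0 i, hi ord0 i]])).
  rewrite /mu lebesgue_rV_box => [|i]; last by rewrite !mxE; lra.
  by rewrite lte_fin; apply: prodr_gt0 => i _; rewrite !mxE; lra.
rewrite le_measure ?inE//; first exact: measurable_box.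
move=> z /= Hz; apply: (He p); first by apply: Koo_x; exists (Ordinal n_gt0).
move=> i; have := Hz i; rewrite in_itv/= !mxE ler_norml => /andP[? ?].
by apply/andP; split; lra.
Qed.

Variable f : 'rV[R]_d -> R.
Hypothesis f_MLE : maximizes_loglik x w F f.

Let f_density : density f. Proof. by have [[]] := f_MLE. Qed.
Let f_lc : log_concave f. Proof. by have [[]] := f_MLE. Qed.
Let f_Q : Q f. Proof. by have [[]] := f_MLE. Qed.
Let f0 z : 0 <= f z. Proof. by have [_] := f_density. Qed.
Let f_meas : measurable_fun setT f. Proof. by have [] := f_density. Qed.

(** Optimality of [f] is tested against the restriction of [g] to [Y], divided by its mass [I]. *)
Let restriction_le (g : 'rV[R]_d -> R) (Y : set 'rV[R]_d) (I : R) : measurable_fun setT g ->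
  (forall z, 0 <= g z) -> log_concave g -> Q g -> (forall k, 0 < g (x k)) ->
  measurable Y -> convex_set Y -> C Y -> range x `<=` Y ->
  0 < I -> (\int[mu]_(z in Y) (g z)%:E = I%:E)%E ->
  ((- ln I + \sum_k w k * ln (g (x k)))%:E <= loglik x w f)%E.
Proof.
move=> mg g0 lg Qg gx mY cY CY xY I0 intg.
have I0' : 0 <= I^-1 by rewrite invr_ge0 ltW.
have [_ /(_ (scaled_restriction I^-1 g Y))] := f_MLE.
rewrite loglik_scaled_restriction ?invr_gt0// lnV ?posrE//; apply.
split; first exact: density_scaled_restriction.
  exact: log_concave_restriction.
exact: Q_restriction.
Qed.

Let uniform_le m : ((- ln (fine (mu (K m))))%:E <= loglik x w f)%E.
Proof.
have := @restriction_le (cst 1) (K m) (fine (mu (K m))).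
under eq_bigr do rewrite /= ln1 mulr0.
rewrite big1// addr0; apply => //.
- by rewrite fine_gt0// mu_K_gt0 ltey_eq mu_K_fin.
- transitivity (\int[mu]_(z in K m) cst 1%E z)%E; first by [].
  by rewrite integral_cst// mul1e fineK.
Qed.

(** Comparison with a uniform density shows that the maximal log-likelihood is not [-oo]. *)
Let f_x k : 0 < f (x k).
Proof.
by apply: (loglik_gtNy w_gt0 (lt_le_trans _ (uniform_le 0%N))); rewrite ltNyr.
Qed.

Let L := \sum_k w k * ln (f (x k)).

(** This is the uniform comparison in exponential form; the bound does not depend on [m], so it
    passes to the intersection. *)
Let mu_K_ge m : ((expR (- L))%:E <= mu (K m))%E.
Proof.
have := uniform_le m; rewrite (loglik_fin _ f_x) lee_fin -/L => H.
have m0 : 0 < fine (mu (K m)) by rewrite fine_gt0// mu_K_gt0 ltey_eq mu_K_fin.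
rewrite -(fineK (mu_K_fin m)) lee_fin -[leRHS]lnK ?posrE// ler_expR.
by rewrite lerNl.
Qed.

Let mu_Koo_gt0 : (0 < mu Koo)%E.
Proof.
apply: (@lt_le_trans _ _ (expR (- L))%:E); first by rewrite lte_fin expR_gt0.
(* Continuity from above, legitimate because [K 0] has finite measure. *)
have cvg := nonincreasing_cvg_mu mu_K0 K_meas Koo_meas K_sub.
rewrite -(cvg_lim _ cvg)//; apply: lime_ge; first by apply/cvg_ex; exists (mu Koo).
by apply: nearW => m; exact: mu_K_ge.
Qed.

Let support_convex : convex_set [set z | 0 < f z].
Proof. exact: convex_support. Qed.

Let Koo_support : Koo `<=` [set z | 0 < f z].
Proof.
apply: (K_min (Q_support f0 f_Q) support_convex) => _ [k _ <-].
exact: f_x.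
Qed.

Let f_measE D : measurable_fun D (EFin \o f).
Proof. by apply/measurable_EFinP; exact: measurable_funS f_meas. Qed.

Let int_split : (\int[mu]_(z in Koo) (f z)%:E + \int[mu]_(z in ~` Koo) (f z)%:E = 1)%E.
Proof.
rewrite -ge0_integral_setU//.
- by rewrite setUv; have [] := f_density.
- exact: measurableC.
- by move=> z _; rewrite lee_fin.
- by rewrite disj_set2E setICr.
Qed.

Let int_Koo : (\int[mu]_(z in Koo) (f z)%:E = 1)%E.
Proof.
have i0 : (0 < \int[mu]_(z in Koo) (f z)%:E)%E by exact: integral_gt0_measure.
have i1 : (\int[mu]_(z in Koo) (f z)%:E <= 1)%E.
  by rewrite -int_split leeDl// integral_ge0// => z _; rewrite lee_fin.
have ifin : (\int[mu]_(z in Koo) (f z)%:E)%E \is a fin_num.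
  by rewrite ge0_fin_numE ?(ltW i0)// (le_lt_trans i1)// ltry.
pose I := fine (\int[mu]_(z in Koo) (f z)%:E)%E.
have IE : (\int[mu]_(z in Koo) (f z)%:E = I%:E)%E by rewrite fineK.
have I0 : 0 < I by rewrite -lte_fin -IE.
(* Restricting [f] itself to [Koo] and renormalizing changes the log-likelihood by [- ln I], so
   optimality forces $I \ge 1$. *)
have := restriction_le f_meas f0 f_lc f_Q f_x Koo_meas Koo_convex Koo_C Koo_x I0 IE.
rewrite (loglik_fin _ f_x) lee_fin -/L gerDr oppr_le0 => lnI.
rewrite IE; apply/eqP; rewrite eqe eq_le -lee_fin -IE i1/=.
by rewrite -ler_ln ?posrE// ln1.
Qed.

Let int_out D : measurable D -> D `<=` ~` Koo -> (\int[mu]_(z in D) (f z)%:E = 0)%E.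
Proof.
move=> mD DK; apply/eqP; rewrite eq_le integral_ge0 ?andbT; last first.
  by move=> z _; rewrite lee_fin.
apply: (@le_trans _ _ (\int[mu]_(z in ~` Koo) (f z)%:E)%E).
  apply: ge0_subset_integral => //; first exact: measurableC.
  by move=> z _; rewrite lee_fin.
have := int_split; rewrite int_Koo.
case: (\int[mu]_(z in ~` Koo) _)%E => //= r [] /eqP.
by rewrite -subr_eq0 addrAC subrr add0r => /eqP ->.
Qed.

Lemma MLE_support : [set z | 0 < f z] = Koo.
Proof.
apply/seteqP; split=> // z fz; apply: contrapT => nKz.
have [m nKm] : exists m, ~ K m z.
  by apply: contrapT => /forallNP H; apply: nKz => m _; exact: contrapT.
have [e e0 He] := K_near m; have [b b0 Kb] := K_bounded.
(* [B] bounds every coordinate distance from [z] to a point of [Koo]; the summand 1 makes division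
   by it safe. *)
pose B := 1 + b + \sum_i `|z ord0 i|.
have B1 : 1 <= B by rewrite /B -addrA lerDl addr_ge0// sumr_ge0.
have yB y i : Koo y -> `|y ord0 i - z ord0 i| <= B.
  move=> /(_ 0%N I)/Kb/(_ i) yb; apply: le_trans (ler_normB _ _) _.
  have : `|z ord0 i| <= \sum_i `|z ord0 i| by rewrite (bigD1 i)//= lerDl sumr_ge0.
  by rewrite /B; lra.
(* The contraction ratio: at most 1, to allow convex combinations, and small enough to bring [Koo]
   within [e] of [z]. *)
pose t := Num.min 1 (e / B).
have t0 : 0 < t by rewrite lt_min ltr01 divr_gt0//; lra.
have t1 : t <= 1 by rewrite ge_min lexx.
have tB : t * B <= e.
  by rewrite -ler_pdivlMr ?ge_min ?lexx ?orbT//; lra.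
(* [T] inverts the contraction of ratio [t] centred at [z], so [E] is the contracted hull, of
   measure $t^d$ times that of [Koo]. *)
pose T v := t^-1 *: v + (z - t^-1 *: z).
pose E := T @^-1` Koo.
have mE : measurable E by rewrite -[E]setTI; exact: measurable_rV_affine.
have muE : (0 < mu E)%E.
  rewrite /mu lebesgue_rV_affine ?invr_gt0// invrK mule_gt0//.
  by rewrite lte_fin exprn_gt0.
have TE v : v = t *: T v + (1 - t) *: z.
  by apply/rowP => i; rewrite !mxE; field; rewrite gt_eqF.
(* A point of [E] in [Koo] would be within [e] of [z] and would put [z] into [K m]. *)
have EK : E `<=` ~` Koo.
  move=> v Ev Kv; apply: nKm; apply: (He v) => // i.
  have -> : v ord0 i - z ord0 i = t * (T v ord0 i - z ord0 i).
    by rewrite !mxE; field; rewrite gt_eqF.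
  rewrite normrM gtr0_norm//; apply: le_trans tB.
  by rewrite ler_wpM2l ?(ltW t0)//; exact: yB.
have Ef v : E v -> 0 < f v.
  move=> /Koo_support Tv; rewrite (TE v).
  have /convex_set_combP := support_convex; apply => //.
  by rewrite (ltW t0) t1.
have := integral_gt0_measure mE f_meas f0 Ef muE.
by rewrite int_out// ltxx.
Qed.

End MLE_support.

(** * Monotonicity, boundedness and intersection of the relaxed hulls *)

Section hull_properties.
Variables (R : realType) (d n : nat) (x : 'I_n -> 'rV[R]_d).

Lemma mm_hull_sub (e e' : R) : e <= e' -> mm_hull x e `<=` mm_hull x e'.
Proof.
by move=> ee' z Hz i j; have [l [sl z1 z2]] := Hz i j; exists l; split=> //; lra.
Qed.

Lemma Lnat_hull_sub (e e' : R) : e <= e' -> Lnat_hull x e `<=` Lnat_hull x e'.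
Proof.
move=> ee' z Hz i j; have [[k1 z1] [k2 z2] [k3 z3]] := Hz i j.
by split; [exists k1|exists k2|exists k3]; lra.
Qed.

Lemma coor_bounded (e : R) (S : set 'rV[R]_d) : 0 <= e ->
  (forall z i, S z -> exists k, z ord0 i < x k ord0 i + e) ->
  (forall z i, S z -> exists k, x k ord0 i - e < z ord0 i) ->
  exists2 b : R, 0 <= b & forall z, S z -> forall i, `|z ord0 i| <= b.
Proof.
move=> e0 Hl Hr; exists (e + \sum_k \sum_i `|x k ord0 i|).
  by rewrite addr_ge0// sumr_ge0// => k _; rewrite sumr_ge0.
have xb k i : `|x k ord0 i| <= \sum_k \sum_i `|x k ord0 i|.
  rewrite (bigD1 k)//= (bigD1 i)//= -addrA lerDl addr_ge0 ?sumr_ge0// => j _.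
  by rewrite sumr_ge0.
move=> z Sz i; have [k zk] := Hl z i Sz; have [h zh] := Hr z i Sz.
have := xb k i; have := xb h i; rewrite !ler_norml => /andP[h1 h2] /andP[h3 h4].
by apply/andP; split; lra.
Qed.

Lemma mm_hull_bounded (e : R) : 0 <= e ->
  exists2 b : R, 0 <= b & forall z, mm_hull x e z -> forall i, `|z ord0 i| <= b.
Proof.
by move=> e0; apply: (coor_bounded e0) => z i;
  [exact: mm_hull_ltr|exact: mm_hull_gtr].
Qed.

Lemma Lnat_hull_bounded (e : R) : 0 <= e ->
  exists2 b : R, 0 <= b & forall z, Lnat_hull x e z -> forall i, `|z ord0 i| <= b.
Proof.
move=> e0; apply: (coor_bounded e0) => z i /(_ i i) [] // _ [k zk] _.
by exists k; lra.
Qed.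

(** This splits a slack into [p] equal shares, each again the inverse of a successor so that it
    indexes a relaxed hull; hence the predecessor. *)
Lemma nat_inv_split (m p : nat) : (0 < p)%N ->
  (m.+1%:R^-1 : R) = ((p * m.+1).-1.+1%:R^-1) *+ p.
Proof.
move=> p0; rewrite prednK ?muln_gt0 ?p0// natrM invfM -[RHS]mulr_natl mulrA divff ?mul1r//.
by rewrite pnatr_eq0 -lt0n.
Qed.

Lemma nonincreasing_inv_sub (H : R -> set 'rV[R]_d) :
  (forall e e', e <= e' -> H e `<=` H e') ->
  nonincreasing_seq (fun m => H m.+1%:R^-1).
Proof.
move=> Hsub p q pq; apply/subsetPset/Hsub.
by rewrite lef_pV2 ?posrE// ler_nat.
Qed.

Lemma mm_hull_MMconv : (0 < n)%N ->
  \bigcap_m mm_hull x m.+1%:R^-1 = MMconv (range x).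
Proof.
move=> n0; apply/seteqP; split.
  by move=> z Hz Y [[mY cY] xY]; exact: mm_hull_min Hz.
apply: smallest_sub.
  split; first by apply: minmax_bigcap => m _; exact: minmax_mm_hull.
  by apply: convex_bigcap => m _; exact: convex_mm_hull.
by move=> z xz m _; apply: range_mm_hull.
Qed.

Lemma Lnat_hull_Lext : (0 < n)%N ->
  \bigcap_m Lnat_hull x m.+1%:R^-1 = Lext (range x).
Proof.
move=> n0; apply/seteqP; split.
  by move=> z Hz Y [LY xY]; exact: Lnat_hull_min Hz.
apply: smallest_sub.
  by apply: Lnat_bigcap => m _; exact: Lnat_Lnat_hull.
by move=> z xz m _; apply: range_Lnat_hull.
Qed.

End hull_properties.

(** * Application to the two shape constraints *)

Theorem proposition2p7 (R : realType) (d n : nat)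
    (x : 'I_n -> 'rV[R]_d) (w : 'I_n -> R)
    (w_gt0 : forall i, 0 < w i) (w_sum : \sum_(i < n) w i = 1) :
  (forall f : 'rV[R]_d -> R, is_log_concave_MTP2_MLE x w f ->
     [set z | 0 < f z] = MMconv (range x)) /\
  (forall f : 'rV[R]_d -> R, is_log_concave_LLC_MLE x w f ->
     [set z | 0 < f z] = Lext (range x)).
Proof.
have n0 := sum1_size_gt0 w_sum.
split=> f f_MLE.
  rewrite -(mm_hull_MMconv x n0).
  apply: (@MLE_support _ _ _ x w w_gt0 w_sum (@MTP2 R d) (@minmax_closed R d)
      _ _ _ _ (fun m => mm_hull x m.+1%:R^-1) _ _ _ _ _ _ _ _ f f_MLE).
  - by move=> u v; rewrite /= lexx.
  - by move=> c g Y c0 g0 CY Qg; exact: MTP2_restriction.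
  - by move=> g g0 Qg; exact: minmax_support.
  - by move=> F CF; apply: minmax_bigcap => m _.
  - by move=> m; exact: convex_mm_hull.
  - by move=> m; exact: minmax_mm_hull.
  - by move=> m; exact: measurable_mm_hull.
  - by apply: nonincreasing_inv_sub => e e'; exact: mm_hull_sub.
  - by move=> m; exact: range_mm_hull.
  - by apply: mm_hull_bounded; rewrite invr_ge0.
  (* Half of the slack goes to the hull and half to the displacement. *)
  - move=> m; exists ((2 * m.+1).-1.+1%:R^-1); first by rewrite invr_gt0.
    move=> y z /(_ (2 * m.+1).-1 I) Hy /(mm_hull_near Hy).
    by rewrite (@nat_inv_split _ m 2)// mulr2n.
  - by move=> Y CY cY xY; exact: mm_hull_min.
rewrite -(Lnat_hull_Lext x n0).
apply: (@MLE_support _ _ _ x w w_gt0 w_sum (@LLC R d) (@Lnat_convex R d)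
      _ _ _ _ (fun m => Lnat_hull x m.+1%:R^-1) _ _ _ _ _ _ _ _ f f_MLE).
- by move=> a u v _; rewrite /= lexx.
- by move=> c g Y c0 g0 CY Qg; exact: LLC_restriction.
- by move=> g g0 Qg; exact: Lnat_support.
- by move=> F CF; apply: Lnat_bigcap => m _.
- by move=> m; exact: convex_Lnat_hull.
- by move=> m; exact: Lnat_Lnat_hull.
- by move=> m; exact: measurable_Lnat_hull.
- by apply: nonincreasing_inv_sub => e e'; exact: Lnat_hull_sub.
- by move=> m; exact: range_Lnat_hull.
- by apply: Lnat_hull_bounded; rewrite invr_ge0.
(* Three shares: one for the hull and two for the displacement, which counts twice in coordinate
   differences. *)
- move=> m; exists ((3 * m.+1).-1.+1%:R^-1); first by rewrite invr_gt0.
  move=> y z /(_ (3 * m.+1).-1 I) Hy /(Lnat_hull_near Hy).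
  by rewrite (@nat_inv_split _ m 3)// -mulrS.
- by move=> Y CY cY xY; exact: Lnat_hull_min.
Qed.
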